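(* Let $N\in\mathbb{N}$, $N\ge 1$, let $X=\{x_1<x_2<\dots<x_N\}\subset(0,1)$, set $x_0:=0$, $x_{N+1}:=1$, $h_i:=x_{i+1}-x_i$ for $0\le i\le N$, and let $\varepsilon>0$. Then the Lebesgue function $\Lambda_{1,\varepsilon,X}$ satisfies $$\Lambda_{1,\varepsilon,X}(x)=\begin{cases}\dfrac{\sinh(\varepsilon x)}{\sinh(\varepsilon h_0)}, & 0<x\le x_1,\\[2mm] 2\,\dfrac{\sinh(\varepsilon h_i/2)}{\sinh(\varepsilon h_i)}\cosh\!\left(\varepsilon\left(x-\dfrac{x_i+x_{i+1}}{2}\right)\right), & x_i\le x\le x_{i+1},\ 1\le i\le N-1,\\[2mm] \dfrac{\sinh(\varepsilon(1-x))}{\sinh(\varepsilon h_N)}, & x_N\le x<1.\end{cases}$$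
   Context: For $\varepsilon>0$ the Brownian Bridge kernel $k_{1,\varepsilon}:(0,1)^2\to\mathbb{R}$ is $$k_{1,\varepsilon}(x,y)=\frac{\sinh(\varepsilon\min(x,y))\,\sinh(\varepsilon(1-\max(x,y)))}{\varepsilon\sinh(\varepsilon)},\quad x,y\in(0,1).$$ It is strictly positive definite on $(0,1)$. The cardinal (Lagrange) basis of $V_{1,\varepsilon}(X)=\operatorname{span}\{k_{1,\varepsilon}(\cdot,x):x\in X\}$ is the family of unique elements $\ell_{1,\varepsilon,i}\in V_{1,\varepsilon}(X)$, $1\le i\le N$, with $\ell_{1,\varepsilon,i}(x_j)=\delta_{ij}$ for $1\le i,j\le N$. The Lebesgue function is $\Lambda_{1,\varepsilon,X}(x):=\sum_{i=1}^N|\ell_{1,\varepsilon,i}(x)|$ for $x\in(0,1)$. *)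

(* Defs.v *)
From Stdlib Require Import Reals Arith ClassicalEpsilon.
Open Scope R_scope.

(* Functions on (0,1) are encoded as total functions R -> R, of which only the
   values on (0,1) are meaningful. *)

Definition bb_kernel (eps x y : R) : R :=
  sinh (eps * Rmin x y) * sinh (eps * (1 - Rmax x y)) / (eps * sinh eps).

(* The nodes are x 1, ..., x N (1-based); [sum_f 1 N] is the sum over the
   indices 1, ..., N when N >= 1. Membership in the span of the kernel
   translates only concerns the values on (0,1). *)
Definition in_span (eps : R) (N : nat) (x : nat -> R) (f : R -> R) : Prop :=
  exists c : nat -> R, forall t : R, 0 < t < 1 ->
    f t = sum_f 1 N (fun j => c j * bb_kernel eps t (x j)).

Definition is_cardinal (eps : R) (N : nat) (x : nat -> R) (i : nat)
    (l : R -> R) : Prop :=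
  in_span eps N x l /\
  forall j : nat, (1 <= j <= N)%nat ->
    l (x j) = if Nat.eq_dec i j then 1 else 0.

(* The chosen function is determined on (0,1), because the kernel is strictly
   positive definite there; its values elsewhere are arbitrary. *)
Definition cardinal (eps : R) (N : nat) (x : nat -> R) (i : nat) : R -> R :=
  epsilon (inhabits (fun _ : R => 0)) (is_cardinal eps N x i).

Definition lebesgue_fun (eps : R) (N : nat) (x : nat -> R) (t : R) : R :=
  sum_f 1 N (fun i => Rabs (cardinal eps N x i t)).

Definition gap (x : nat -> R) (i : nat) : R := x (S i) - x i.

(* Main.v *)
(** Between two consecutive nodes [a < b] every kernel translate, hence every
    [f] in the span, solves [f'' = eps^2 f], so that
    [sinh (eps (b - a)) f(t) = sinh (eps (b - t)) f(a) + sinh (eps (t - a)) f(b)];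
    this also holds on the two end intervals with the value [0] at [0] and [1].
    A cardinal function is therefore determined by its nodal values, and at most
    two of them are nonzero at a given point.  Both this interpolation formula
    and the explicit three-term combination of kernel translates giving the
    cardinal functions rest on the Plücker relation for
    [(a, b) |-> sinh (eps (b - a))], a 2 by 2 determinant in the vectors
    [(exp (eps a), exp (- eps a))]. *)

Require Import Defs.
From Stdlib Require Import Reals Arith Lra Lia ClassicalEpsilon.
Open Scope R_scope.

(** * Identities and signs for the hyperbolic sine *)

Lemma sinh_sub_exp (e a b : R) :
  sinh (e * (b - a)) =
    (exp (e * b) * exp (- (e * a)) - exp (- (e * b)) * exp (e * a)) / 2.
Proof.
  unfold sinh. rewrite <- !exp_plus.
  replace (e * (b - a)) with (e * b + - (e * a)) by ring.
  replace (- (e * b + - (e * a))) with (- (e * b) + e * a) by ring.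
  reflexivity.
Qed.

(** In terms of the exponentials this is a polynomial identity, the exponentials being independent
    variables. *)
Lemma sinh_pluecker (e a b c d : R) :
  sinh (e * (c - a)) * sinh (e * (d - b)) =
    sinh (e * (b - a)) * sinh (e * (d - c)) +
    sinh (e * (d - a)) * sinh (e * (c - b)).
Proof. rewrite !sinh_sub_exp. field. Qed.

Lemma sinh_pos (u : R) : 0 < u -> 0 < sinh u.
Proof. intros H. rewrite <- sinh_0. now apply sinh_lt. Qed.

Lemma sinh_gap_pos (e a b : R) : 0 < e -> a < b -> 0 < sinh (e * (b - a)).
Proof. intros He Hab. apply sinh_pos, Rmult_lt_0_compat; lra. Qed.

Lemma sinh_gap_nonneg (e a b : R) : 0 < e -> a <= b -> 0 <= sinh (e * (b - a)).
Proof.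
  intros He [Hab | ->].
  - now apply Rlt_le, sinh_gap_pos.
  - rewrite Rminus_diag, Rmult_0_r, sinh_0. lra.
Qed.

Lemma sinh_add_sinh (u v : R) :
  sinh u + sinh v = 2 * sinh ((u + v) / 2) * cosh ((v - u) / 2).
Proof.
  assert (Hu : u = (u + v) / 2 + - ((v - u) / 2)) by field.
  assert (Hv : v = (u + v) / 2 + (v - u) / 2) by field.
  revert Hu Hv. generalize ((u + v) / 2) ((v - u) / 2). intros p q -> ->.
  unfold sinh, cosh.
  rewrite !Ropp_plus_distr, Ropp_involutive, !exp_plus. field.
Qed.

(** * Boundary values, interpolation and peak of the kernel *)

Lemma bb_kernel_sym (e s t : R) : bb_kernel e s t = bb_kernel e t s.
Proof. unfold bb_kernel. now rewrite Rmin_comm, Rmax_comm. Qed.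

(** Writing [s - 0] and [1 - 0] gives every factor the shape [sinh (e * (b - a))], ready for
    [sinh_pluecker] with [0] or [1] among the points. *)
Lemma bb_kernel_le (e s t : R) : s <= t ->
  bb_kernel e s t =
    sinh (e * (s - 0)) * sinh (e * (1 - t)) / (e * sinh (e * (1 - 0))).
Proof.
  intros H. unfold bb_kernel. rewrite Rmin_left, Rmax_right by assumption.
  now rewrite !Rminus_0_r, Rmult_1_r.
Qed.

Lemma bb_kernel_0_l (e t : R) : 0 <= t -> bb_kernel e 0 t = 0.
Proof.
  intros H. rewrite bb_kernel_le by assumption.
  rewrite Rminus_diag, Rmult_0_r, sinh_0. unfold Rdiv. ring.
Qed.

Lemma bb_kernel_1_l (e t : R) : t <= 1 -> bb_kernel e 1 t = 0.
Proof.
  intros H. rewrite bb_kernel_sym, bb_kernel_le by assumption.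
  rewrite (Rminus_diag 1), Rmult_0_r, sinh_0. unfold Rdiv. ring.
Qed.

(** For [y] on one side of the interval, one factor of the kernel is constant in [t]; the other
    involves the distance from [t] to [1] or to [0]. The Plücker relation is applied to [a, t, b, 1]
    or to [0, a, t, b]. *)
Lemma bb_kernel_interp (e a b t y : R) : a <= t <= b -> y <= a \/ b <= y ->
  sinh (e * (b - a)) * bb_kernel e t y =
    sinh (e * (b - t)) * bb_kernel e a y + sinh (e * (t - a)) * bb_kernel e b y.
Proof.
  intros [Hat Htb] [Hy | Hy].
  - rewrite !(bb_kernel_sym _ _ y), !bb_kernel_le by lra.
    pose proof (sinh_pluecker e a t b 1) as P. unfold Rdiv.
    rewrite <- !Rmult_assoc, <- Rmult_plus_distr_r. f_equal.
    transitivity (sinh (e * (y - 0)) *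
      (sinh (e * (b - a)) * sinh (e * (1 - t)))); [ring | rewrite P; ring].
  - rewrite !bb_kernel_le by lra.
    pose proof (sinh_pluecker e 0 a t b) as P. unfold Rdiv.
    rewrite <- !Rmult_assoc, <- Rmult_plus_distr_r. f_equal.
    transitivity (sinh (e * (1 - y)) *
      (sinh (e * (t - 0)) * sinh (e * (b - a)))); [ring | rewrite P; ring].
Qed.

(** The second difference of the Green's function [bb_kernel] on the diagonal. *)
Lemma bb_kernel_peak (e a b c : R) : 0 < e -> a <= b <= c ->
  sinh (e * (c - a)) * bb_kernel e b b - sinh (e * (c - b)) * bb_kernel e b a
    - sinh (e * (b - a)) * bb_kernel e b c =
  sinh (e * (b - a)) * sinh (e * (c - b)) / e.
Proof.
  intros He [Hab Hbc].
  rewrite (bb_kernel_sym e b a), !bb_kernel_le by lra.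
  assert (H1 : 0 < sinh (e * (1 - 0))) by (apply sinh_gap_pos; lra).
  (* [P] cancels the term with [a]; then [Q] cancels the term with [c] and leaves a factor [S], the
     one in the denominator of the kernel. *)
  pose proof (sinh_pluecker e 0 a b c) as P.
  pose proof (sinh_pluecker e 0 b c 1) as Q.
  set (S := sinh (e * (1 - 0))) in *.
  apply (Rmult_eq_reg_r (e * S)); [| apply Rmult_integral_contrapositive; lra].
  field_simplify; [| lra | lra].
  transitivity
    (sinh (e * (1 - b)) * (sinh (e * (b - 0)) * sinh (e * (c - a)))
     - sinh (e * (c - b)) * sinh (e * (a - 0)) * sinh (e * (1 - b))
     - sinh (e * (b - a)) * sinh (e * (b - 0)) * sinh (e * (1 - c)));
    [ring | rewrite P].
  transitivity
    (sinh (e * (b - a)) * (sinh (e * (c - 0)) * sinh (e * (1 - b)))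
     - sinh (e * (b - a)) * sinh (e * (b - 0)) * sinh (e * (1 - c)));
    [ring | rewrite Q; ring].
Qed.

(** * Finite sums and Kronecker deltas *)

(** For [n < s] truncated subtraction leaves [sum_f s n f] with the single term [f s], hence the
    hypothesis [s <= n]. *)
Lemma sum_f_ext (s n : nat) (f g : nat -> R) : (s <= n)%nat ->
  (forall j, (s <= j <= n)%nat -> f j = g j) -> sum_f s n f = sum_f s n g.
Proof. intros Hsn H. apply sum_eq. intros j Hj. apply H. lia. Qed.

Lemma sum_f_lin (s n : nat) (a b : R) (f g : nat -> R) :
  sum_f s n (fun j => a * f j + b * g j) = a * sum_f s n f + b * sum_f s n g.
Proof.
  unfold sum_f. rewrite plus_sum, !scal_sum.
  f_equal; apply sum_eq; intros; ring.
Qed.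

Definition kron (i j : nat) : R := if Nat.eq_dec i j then 1 else 0.

Lemma kron_diag (i : nat) : kron i i = 1.
Proof. unfold kron. now destruct (Nat.eq_dec i i). Qed.

Lemma kron_neq (i j : nat) : i <> j -> kron i j = 0.
Proof. intros H. unfold kron. now destruct (Nat.eq_dec i j). Qed.

Lemma sum_f_kron_out (s n i : nat) (f : nat -> R) : (s <= n)%nat ->
  (i < s \/ n < i)%nat -> sum_f s n (fun j => kron i j * f j) = 0.
Proof.
  intros Hsn Hi. unfold sum_f.
  apply sum_eq_R0. intros k Hk. rewrite kron_neq by lia. ring.
Qed.

Lemma sum_f_kron (s n i : nat) (f : nat -> R) : (s <= i <= n)%nat ->
  sum_f s n (fun j => kron i j * f j) = f i.
Proof.
  intros Hi. assert (Hsn : (s <= n)%nat) by lia.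
  revert Hi. pattern n. revert n Hsn.
  apply Nat.le_ind; [now intros ? ? -> | |].
  - intros Hi. replace i with s by lia.
    unfold sum_f. rewrite Nat.sub_diag. simpl. rewrite kron_diag. ring.
  - intros n Hsn IH Hi.
    assert (E : forall g, sum_f s (S n) g = sum_f s n g + g (S n)).
    { intros g. unfold sum_f. rewrite Nat.sub_succ_l by assumption. simpl.
      f_equal. f_equal. lia. }
    rewrite E. destruct (Nat.eq_dec i (S n)) as [-> | Hne].
    + rewrite sum_f_kron_out, kron_diag by lia. ring.
    + rewrite IH, kron_neq by lia. ring.
Qed.

(** * The grid of nodes and end points *)

(** Nodes and end points form one increasing sequence, so that the two end intervals are treated
    like the others. *)
Definition node_grid (N : nat) (x : nat -> R) : Prop :=
  x 0%nat = 0 /\ x (S N) = 1 /\ forall i, (i <= N)%nat -> x i < x (S i).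

Lemma node_grid_lt (N : nat) (x : nat -> R) (i j : nat) : node_grid N x ->
  (i < j <= S N)%nat -> x i < x j.
Proof.
  intros (_ & _ & Hx) [Hij Hj]. induction Hij as [| j Hij IH].
  - apply Hx. lia.
  - apply (Rlt_trans _ (x j)); [apply IH | apply Hx]; lia.
Qed.

Lemma node_grid_le (N : nat) (x : nat -> R) (i j : nat) : node_grid N x ->
  (i <= j <= S N)%nat -> x i <= x j.
Proof.
  intros Hx Hij. destruct (Nat.eq_dec i j) as [-> | Hne]; [lra |].
  apply Rlt_le, (node_grid_lt N); [assumption | lia].
Qed.

Lemma node_grid_range (N : nat) (x : nat -> R) (i : nat) : node_grid N x ->
  (i <= S N)%nat -> 0 <= x i <= 1.
Proof.
  intros Hx Hi. pose proof Hx as (H0 & H1 & _). rewrite <- H0, <- H1.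
  split; apply (node_grid_le N); trivial; lia.
Qed.

Lemma node_grid_inner (N : nat) (x : nat -> R) (i : nat) : node_grid N x ->
  (1 <= i <= N)%nat -> 0 < x i < 1.
Proof.
  intros Hx Hi. pose proof Hx as (H0 & H1 & _). rewrite <- H0, <- H1.
  split; apply (node_grid_lt N); trivial; lia.
Qed.

(** The indices [0] and [S N] are allowed: the corresponding translates are the
    kernel at the end points, which vanishes. *)
Lemma sum_f_kron_kernel (eps : R) (N : nat) (x : nat -> R) (i : nat) (t : R) :
  (1 <= N)%nat -> node_grid N x -> (i <= S N)%nat -> 0 <= t <= 1 ->
  sum_f 1 N (fun j => kron i j * bb_kernel eps t (x j)) = bb_kernel eps t (x i).
Proof.
  intros HN Hx Hi Ht. pose proof Hx as (H0 & H1 & _).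
  destruct (Nat.eq_dec i 0) as [-> | Hi0];
    [| destruct (Nat.eq_dec i (S N)) as [-> | Hi1]].
  - rewrite sum_f_kron_out, H0, bb_kernel_sym, bb_kernel_0_l; trivial; lia || lra.
  - rewrite sum_f_kron_out, H1, bb_kernel_sym, bb_kernel_1_l; trivial; lia || lra.
  - apply (sum_f_kron 1 N i (fun j => bb_kernel eps t (x j))). lia.
Qed.

(** * Existence and evaluation of cardinal functions *)

Lemma cardinal_exists (eps : R) (N : nat) (x : nat -> R) (i : nat) :
  0 < eps -> (1 <= N)%nat -> node_grid N x -> (1 <= i <= N)%nat ->
  exists l, is_cardinal eps N x i l.
Proof.
  intros He HN Hx Hi. destruct i as [| p]; [lia |].
  set (q := S p) in *. set (r := S q).
  assert (Hpq : 0 < sinh (eps * (x q - x p)))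
    by (apply sinh_gap_pos, (node_grid_lt N); trivial; unfold q; lia).
  assert (Hqr : 0 < sinh (eps * (x r - x q)))
    by (apply sinh_gap_pos, (node_grid_lt N); trivial; unfold r; lia).
  (* [C] is the reciprocal of the peak value in [bb_kernel_peak]. *)
  set (C := eps / (sinh (eps * (x q - x p)) * sinh (eps * (x r - x q)))).
  (* If [p] is [0] or [r] is [S N], its delta misses the range of summation, in agreement with the
     vanishing translate. The factor [1] fits [sum_f_lin]. *)
  set (c := fun j =>
    C * sinh (eps * (x r - x p)) * kron q j +
    1 * (- (C * sinh (eps * (x r - x q))) * kron p j +
         - (C * sinh (eps * (x q - x p))) * kron r j)).
  assert (E : forall t, 0 <= t <= 1 ->
    sum_f 1 N (fun j => c j * bb_kernel eps t (x j)) =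
    C * (sinh (eps * (x r - x p)) * bb_kernel eps t (x q)
         - sinh (eps * (x r - x q)) * bb_kernel eps t (x p)
         - sinh (eps * (x q - x p)) * bb_kernel eps t (x r))).
  { intros t Ht.
    rewrite <- (sum_f_kron_kernel eps N x p t) by (trivial; lia).
    rewrite <- (sum_f_kron_kernel eps N x q t) by (trivial; lia).
    rewrite <- (sum_f_kron_kernel eps N x r t) by (trivial; unfold r; lia).
    etransitivity; [apply sum_f_ext; [lia |] |].
    - intros j _. unfold c.
      instantiate (1 := fun j =>
        C * sinh (eps * (x r - x p)) * (kron q j * bb_kernel eps t (x j)) +
        1 * (- (C * sinh (eps * (x r - x q))) * (kron p j * bb_kernel eps t (x j)) +
             - (C * sinh (eps * (x q - x p))) * (kron r j * bb_kernel eps t (x j)))).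
      simpl. ring.
    - rewrite !sum_f_lin. ring. }
  exists (fun t => sum_f 1 N (fun j => c j * bb_kernel eps t (x j))).
  split; [now exists c |]. intros j Hj.
  rewrite E by (apply (node_grid_range N); trivial; lia).
  change (if Nat.eq_dec q j then 1 else 0) with (kron q j).
  destruct (Nat.eq_dec q j) as [<- | Hne].
  - rewrite kron_diag, bb_kernel_peak.
    + unfold C. field. lra.
    + assumption.
    + split; apply (node_grid_le N); trivial; unfold r, q; lia.
  (* Symmetry turns [x j] into the parameter [y] of [bb_kernel_interp]; as [j] differs from [q], it
     is not strictly between [x p] and [x r], and the second difference vanishes. *)
  - rewrite kron_neq, !(bb_kernel_sym _ (x j)) by assumption.
    rewrite (bb_kernel_interp eps (x p) (x r)).
    + ring.
    + split; apply (node_grid_le N); trivial; unfold r, q; lia.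
    + destruct (Nat.lt_ge_cases j q); [left | right];
        apply (node_grid_le N); trivial; unfold r, q in *; lia.
Qed.

Lemma cardinal_spec (eps : R) (N : nat) (x : nat -> R) (i : nat) :
  0 < eps -> (1 <= N)%nat -> node_grid N x -> (1 <= i <= N)%nat ->
  is_cardinal eps N x i (cardinal eps N x i).
Proof. intros. unfold cardinal. now apply epsilon_spec, cardinal_exists. Qed.

(** Interpolation is linear in the function, so it passes from the translates to [l]. Since [l] is
    arbitrary, this also gives uniqueness on (0,1). *)
Lemma is_cardinal_eval (eps : R) (N : nat) (x : nat -> R) (j : nat)
    (l : R -> R) (i : nat) (t : R) :
  0 < eps -> (1 <= N)%nat -> node_grid N x -> (1 <= j <= N)%nat ->
  is_cardinal eps N x j l -> (i <= N)%nat -> x i <= t <= x (S i) -> 0 < t < 1 ->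
  l t = (kron i j * sinh (eps * (x (S i) - t)) +
         kron (S i) j * sinh (eps * (t - x i))) / sinh (eps * gap x i).
Proof.
  intros He HN Hx Hj [[c Hc] Hl] Hi Ht Ht01. pose proof Hx as (H0 & H1 & Hlt).
  (* Unlike [l], the sum [g] is controlled at [0] and [1] too, where it vanishes. *)
  set (g := fun t => sum_f 1 N (fun k => c k * bb_kernel eps t (x k))).
  assert (Hg : forall m, (m <= S N)%nat -> g (x m) = kron m j).
  { intros m Hm.
    destruct (Nat.eq_dec m 0) as [-> | Hm0];
      [| destruct (Nat.eq_dec m (S N)) as [-> | Hm1]].
    - rewrite H0, kron_neq by lia. apply sum_eq_R0. intros k Hk.
      rewrite bb_kernel_0_l; [ring |]. apply (node_grid_range N); trivial; lia.
    - rewrite H1, kron_neq by lia. apply sum_eq_R0. intros k Hk.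
      rewrite bb_kernel_1_l; [ring |]. apply (node_grid_range N); trivial; lia.
    - unfold g. rewrite <- Hc by (apply (node_grid_inner N); trivial; lia).
      rewrite Hl by lia. unfold kron.
      destruct (Nat.eq_dec j m), (Nat.eq_dec m j); congruence. }
  assert (Hs : 0 < sinh (eps * gap x i)) by (apply sinh_gap_pos; auto).
  rewrite Hc by assumption. fold (g t).
  rewrite <- (Hg i), <- (Hg (S i)) by lia.
  apply (Rmult_eq_reg_l (sinh (eps * gap x i))); [| lra].
  transitivity (sinh (eps * (x (S i) - t)) * g (x i) +
                sinh (eps * (t - x i)) * g (x (S i))); [| field; lra].
  (* The zero term makes the left side a combination of two sums, as [sum_f_lin] expects. *)
  transitivity (sinh (eps * gap x i) * g t + 0 * g t); [ring |].
  unfold g. rewrite <- !sum_f_lin. apply sum_f_ext; [assumption |].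
  intros k Hk.
  transitivity (c k * (sinh (eps * gap x i) * bb_kernel eps t (x k))); [ring |].
  unfold gap. rewrite (bb_kernel_interp eps (x i) (x (S i))); [ring | assumption |].
  destruct (Nat.lt_ge_cases i k); [right | left];
    apply (node_grid_le N); trivial; lia.
Qed.

(** * The Lebesgue function on each interval *)

(** Both interpolation weights are nonnegative, so the absolute values drop. Each delta sum is [1]
    at a node index and [0] at the indices [0] and [S N]. *)
Lemma lebesgue_fun_eval (eps : R) (N : nat) (x : nat -> R) (i : nat) (t : R) :
  0 < eps -> (1 <= N)%nat -> node_grid N x ->
  (i <= N)%nat -> x i <= t <= x (S i) -> 0 < t < 1 ->
  lebesgue_fun eps N x t =
    sinh (eps * (x (S i) - t)) / sinh (eps * gap x i)
      * sum_f 1 N (fun j => kron i j * 1) +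
    sinh (eps * (t - x i)) / sinh (eps * gap x i)
      * sum_f 1 N (fun j => kron (S i) j * 1).
Proof.
  intros He HN Hx Hi Ht Ht01. pose proof Hx as (_ & _ & Hlt).
  assert (Hs : 0 < sinh (eps * gap x i)) by (apply sinh_gap_pos; auto).
  assert (Hk : forall m k, 0 <= kron m k)
    by (intros m k; unfold kron; destruct (Nat.eq_dec m k); lra).
  rewrite <- sum_f_lin. apply sum_f_ext; [assumption |]. intros j Hj.
  rewrite (is_cardinal_eval eps N x j _ i t) by (trivial; now apply cardinal_spec).
  rewrite Rabs_pos_eq; [field; lra |].
  apply Rmult_le_pos; [| now apply Rlt_le, Rinv_0_lt_compat].
  apply Rplus_le_le_0_compat; apply Rmult_le_pos; trivial;
    apply sinh_gap_nonneg; tauto.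
Qed.

Theorem proposition2 (N : nat) (x : nat -> R) (eps : R)
  (hN : (1 <= N)%nat)
  (hin : forall i : nat, (1 <= i <= N)%nat -> 0 < x i < 1)
  (hincr : forall i : nat, (1 <= i)%nat -> (i < N)%nat -> x i < x (S i))
  (hx0 : x 0%nat = 0)
  (hxN1 : x (S N) = 1)
  (heps : 0 < eps) :
  (forall t : R, 0 < t <= x 1%nat ->
     lebesgue_fun eps N x t = sinh (eps * t) / sinh (eps * gap x 0)) /\
  (forall (i : nat) (t : R), (1 <= i <= N - 1)%nat -> x i <= t <= x (S i) ->
     lebesgue_fun eps N x t =
       2 * (sinh (eps * gap x i / 2) / sinh (eps * gap x i))
         * cosh (eps * (t - (x i + x (S i)) / 2))) /\
  (forall t : R, x N <= t < 1 ->
     lebesgue_fun eps N x t = sinh (eps * (1 - t)) / sinh (eps * gap x N)).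
Proof.
  assert (Hx : node_grid N x).
  { split; [assumption | split; [assumption |]]. intros i Hi.
    destruct (Nat.eq_dec i 0) as [-> | Hi0];
      [| destruct (Nat.eq_dec i N) as [-> | HiN]].
    - rewrite hx0. apply hin. lia.
    - rewrite hxN1. apply hin. lia.
    - apply hincr; lia. }
  split; [| split].
  - intros t Ht. pose proof (hin 1%nat ltac:(lia)).
    rewrite (lebesgue_fun_eval eps N x 0 t) by (trivial; lia || lra).
    rewrite sum_f_kron_out, (sum_f_kron 1 N 1 (fun _ => 1)), hx0, Rminus_0_r by lia.
    ring.
  - intros i t Hi Ht.
    pose proof (hin i ltac:(lia)). pose proof (hin (S i) ltac:(lia)).
    assert (Hs : 0 < sinh (eps * gap x i))
      by (apply sinh_gap_pos, hincr; trivial; lia).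
    rewrite (lebesgue_fun_eval eps N x i t) by (trivial; lia || lra).
    rewrite (sum_f_kron 1 N i (fun _ => 1)), (sum_f_kron 1 N (S i) (fun _ => 1)) by lia.
    (* Both neighbours are nodes, so both weights survive; the half-difference of their arguments is
       [eps] times the offset of [t] from the midpoint. *)
    transitivity ((sinh (eps * (x (S i) - t)) + sinh (eps * (t - x i)))
                  / sinh (eps * gap x i)); [field; lra |].
    rewrite sinh_add_sinh.
    replace ((eps * (x (S i) - t) + eps * (t - x i)) / 2)
      with (eps * gap x i / 2) by (unfold gap; field).
    replace ((eps * (t - x i) - eps * (x (S i) - t)) / 2)
      with (eps * (t - (x i + x (S i)) / 2)) by field.
    field; lra.
  - intros t Ht. pose proof (hin N ltac:(lia)).
    rewrite (lebesgue_fun_eval eps N x N t) by (trivial; lia || lra).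
    rewrite (sum_f_kron 1 N N (fun _ => 1)), sum_f_kron_out, hxN1 by lia.
    ring.
Qed.
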